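(* The SUSP capacity is achieved by simplifiable SUSPs. That is, if $C$ denotes the SUSP capacity, then for infinitely many values of $k$ there exist simplifiable SUSPs of width $k$ and size $(C-o(1))^k$; equivalently, there are $(s_i,k_i)$-puzzles $P_i$ ($i\in\mathbb{N}$) that are simplifiable SUSPs with $k_i\to\infty$ and $s_i^{1/k_i}\to C$.
   Context: Puzzles. For $s,k\in\mathbb{N}$, an $(s,k)$-puzzle is a subset $P\subseteq\{1,2,3\}^k$ with $|P|=s$; $s$ is its size and $k$ its width. SUSP. An $(s,k)$-puzzle $P$ is a strong uniquely solvable puzzle (SUSP) if for all permutations $\pi_1,\pi_2,\pi_3$ of the set $P$, either $\pi_1=\pi_2=\pi_3$, or there exist $r\in P$ and $i\in\{1,\dots,k\}$ such that exactly two of the following hold: $(\pi_1(r))_i=1$, $(\pi_2(r))_i=2$, $(\pi_3(r))_i=3$. SUSP capacity. The SUSP capacity is the largest constant $C$ such that there exist SUSPs of size $(C-o(1))^k$ and width $k$ for infinitely many values of $k$. 3D graphs. A 3D graph $H$ with finite domain $U$ is given by an edge set $E(H)\subseteq U^3$ (a 3-uniform hypergraph on three disjoint copies of $U$). Its projections are the 2D graphs $R_0,R_1,R_2$ on $U$ with edge sets $E(R_0)=\{(v,w): \exists u,\ (u,v,w)\in E(H)\}$, $E(R_1)=\{(u,w):\exists v,\ (u,v,w)\in E(H)\}$, $E(R_2)=\{(u,v):\exists w,\ (u,v,w)\in E(H)\}$. The trivial matching on $U$ is $\{(u,u,u):u\in U\}$. Simplification. Let $S\subseteq U$ and $f\in\{0,1,2\}$.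 $S$ induces a simplification of $R_f$ if $E(R_f)\cap (S\times(U\setminus S))=\emptyset$ or $E(R_f)\cap((U\setminus S)\times S)=\emptyset$. In that case the simplification of $H$ induced by $S$ via $R_f$ is the 3D graph obtained from $H$ by deleting every edge whose projection to $R_f$ (i.e. the pair obtained by dropping the first, second, or third coordinate for $f=0,1,2$ respectively) lies in $(S\times(U\setminus S))\cup((U\setminus S)\times S)$. $H$ simplifies to $H'$ if there is a finite (possibly empty) sequence $H=H_0,H_1,\dots,H_\ell=H'$ and pairs $(S_j,f_j)$ such that $H_j$ is the simplification of $H_{j-1}$ induced by $S_j$ via the projection $R_{f_j}$ of $H_{j-1}$, for each $1\le j\le \ell$ (projections are recomputed at each step). The graph $H_P$. For a puzzle $P\subseteq\{1,2,3\}^k$, $H_P$ is the 3D graph with domain $P$ in which $(u,v,w)\in P^3$ is an edge if and only if there is no $i\in\{1,\dots,k\}$ such that exactly two of the conditions $u_i=1$, $v_i=2$, $w_i=3$ hold. Simplifiable SUSP. An $(s,k)$-puzzle $P$ is a simplifiable SUSP if $H_P$ simplifies to the 3D graph whose edge set is the trivial matching $\{(u,u,u):u\in P\}$. *)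

(* Defs.v *)
(* MathComp, with MathComp-Analysis for the reals. *)
From HB Require Import structures.
From mathcomp Require Import all_boot all_order all_algebra all_fingroup.
From mathcomp Require Import all_classical all_reals all_analysis.

Set Implicit Arguments.
Unset Strict Implicit.
Unset Printing Implicit Defensive.

Import Order.TTheory GRing.Theory Num.Theory.
Import numFieldNormedType.Exports.
Local Open Scope ring_scope.

(* The symbols 1, 2, 3 are represented by the elements 0, 1, 2 of 'I_3. *)
Definition sym1 : 'I_3 := @Ordinal 3 0 isT.
Definition sym2 : 'I_3 := @Ordinal 3 1 isT.
Definition sym3 : 'I_3 := @Ordinal 3 2 isT.

Definition puzzle (k : nat) : Type := {set {ffun 'I_k -> 'I_3}}.

Definition prow (k : nat) (P : puzzle k) : finType :=
  {r : {ffun 'I_k -> 'I_3} | r \in P}.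

Definition exactly_two (a b c : bool) : bool := (a + b + c == 2)%N.

Definition exactly_two_at (k : nat) (P : puzzle k) (u v w : prow P)
    (i : 'I_k) : bool :=
  exactly_two (val u i == sym1) (val v i == sym2) (val w i == sym3).

Definition SUSP (k : nat) (P : puzzle k) : Prop :=
  forall pi1 pi2 pi3 : {perm (prow P)},
    (pi1 = pi2 /\ pi2 = pi3) \/
    (exists (r : prow P) (i : 'I_k),
        exactly_two_at (pi1 r) (pi2 r) (pi3 r) i).

(* A 3D graph is given by its edges ((u, v), w). *)
Definition graph3 (U : finType) : Type := {set U * U * U}.

Definition drop_coord (U : finType) (f : 'I_3) (e : U * U * U) : U * U :=
  match val f with
  | 0%N => (e.1.2, e.2)
  | 1%N => (e.1.1, e.2)
  | _ => (e.1.1, e.1.2)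
  end.

Definition projection (U : finType) (f : 'I_3) (H : graph3 U) : {set U * U} :=
  [set drop_coord f e | e in H].

Definition trivial_matching (U : finType) : graph3 U :=
  [set (u, u, u) | u : U].

Definition induces_simplification (U : finType) (S : {set U})
    (E : {set U * U}) : Prop :=
  E :&: finset.setX S (~: S) = finset.set0 \/
  E :&: finset.setX (~: S) S = finset.set0.

Definition simplification (U : finType) (S : {set U}) (f : 'I_3)
    (H : graph3 U) : graph3 U :=
  [set e in H | drop_coord f e \notin
     finset.setX S (~: S) :|: finset.setX (~: S) S].

Inductive simplifies_to (U : finType) (H : graph3 U) : graph3 U -> Prop :=
| simplifies_refl : simplifies_to H H
| simplifies_step (H' : graph3 U) (S : {set U}) (f : 'I_3) :
    simplifies_to H H' ->
    induces_simplification S (projection f H') ->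
    simplifies_to H (simplification S f H').

Definition puzzle_graph (k : nat) (P : puzzle k) : graph3 (prow P) :=
  [set e : prow P * prow P * prow P |
     ~~ [exists i : 'I_k, exactly_two_at e.1.1 e.1.2 e.2 i]].

Definition simplifiable_SUSP (k : nat) (P : puzzle k) : Prop :=
  simplifies_to (puzzle_graph P) (trivial_matching (prow P)).

(* For infinitely many k, some puzzle in F has width k and size
   (C - o(1))^k; the o(1) term may have either sign. *)
Definition achieves (R : realType) (F : forall k : nat, puzzle k -> Prop)
    (C : R) : Prop :=
  exists eps : nat -> R,
    (eps n @[n --> \oo] --> (0 : R))%classic /\
    forall N : nat, exists (k : nat) (P : puzzle k),
      [/\ (N <= k)%N, F k P & #|P|%:R = (C - eps k) ^+ k].

Definition is_SUSP_capacity (R : realType) (C : R) : Prop :=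
  achieves SUSP C /\ forall C' : R, achieves SUSP C' -> C' <= C.

Lemma achieves_approx (R : realType) (F : forall k : nat, puzzle k -> Prop)
    (C : R) :
  (forall n : nat, exists (k : nat) (P : puzzle k) (r : R),
      [/\ (n <= k)%N, F k P, `|C - r| < n.+1%:R^-1 & #|P|%:R = r ^+ k]) ->
  achieves F C.
Proof.
move=> /choice[k_ kP].
pose good k r := exists n (P : puzzle k),
  [/\ k = k_ n, F k P, `|C - r| < n.+1%:R^-1 & #|P|%:R = r ^+ k].
have /choice[r_ rP] k : exists r : R,
    (exists r', good k r') -> good k r.
  have [[r' gr']|ngr] := pselect (exists r', good k r'); first by exists r'.
  by exists 0 => /ngr.
have goodk n : good (k_ n) (r_ (k_ n)).
  apply: rP; have [P [r [_ FP Cr cP]]] := kP n.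
  by exists r, n, P.
exists (fun k => if `[< exists r', good k r' >] then C - r_ k else 0); split.
  apply/cvgrPdist_lt => e e0.
  have [M] := @ltr_add_invr R 0 e e0; rewrite add0r => Me.
  exists (\sum_(n < M) k_ n).+1 => // k /= kM.
  case: asboolP => [/rP[n [P [kn _ Cr _]]]|_]; last by rewrite subrr normr0.
  rewrite sub0r normrN (lt_trans (lt_le_trans Cr _) Me)//.
  rewrite lef_pV2 ?posrE// ler_nat ltnS leqNgt; apply/negP => nM.
  move: kM; rewrite kn (bigD1 (Ordinal nM))//= ltnNge.
  by rewrite leq_addr.
move=> N; have [n [P [kn FP _ cP]]] := goodk N.
exists (k_ N), P; split=> //; first by have [? [? []]] := kP N.
rewrite asboolT; last by exists (r_ (k_ N)).
by rewrite subKr.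
Qed.

Lemma SUSP_capacity_exists (R : realType) : exists C : R, is_SUSP_capacity C.
Proof.
pose A : classical_sets.set R := fun C => achieves SUSP C.
have ubA : ubound A 3.
  move=> C [eps [eps0 inf]]; rewrite leNgt; apply/negP => C3.
  have {}C3 : 0 < C - 3 by rewrite subr_gt0.
  move/cvgrPdist_lt : eps0 => /(_ _ C3)[N _ NP].
  have [k [P [Nk _ cP]]] := inf N.+1.
  have := NP k (ltnW Nk); rewrite /= sub0r normrN => epsC.
  have e3 : 3 < C - eps k.
    by rewrite ltrBrDl -ltrBrDr (le_lt_trans (ler_norm _)).
  have : (#|P| <= 3 ^ k)%N.
    by rewrite (leq_trans (max_card _))// card_ffun !card_ord.
  apply/negP; rewrite -ltnNge -(ltr_nat R) natrX cP ltrXn2r//.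
  by rewrite -lt0n (leq_trans _ Nk).
have A1 : A 1.
  apply: achieves_approx => n.
  exists n, [set [ffun=> sym1]]%SET, 1; split=> //.
  - move=> p1 p2 p3; left.
    have all1 (x y : prow [set [ffun=> sym1] : {ffun 'I_n -> 'I_3}]%SET) :
        x = y.
      apply: val_inj; have := valP x; have := valP y.
      by rewrite !finset.inE => /eqP -> /eqP ->.
    by split; apply/permP => x; exact: all1.
  - by rewrite subrr normr0 invr_gt0.
  - by rewrite cards1 expr1n.
have supA : has_sup A by split; [exists 1 | exists 3].
exists (sup A); split; last by move=> C' AC'; exact: ub_le_sup (proj2 supA) _ AC'.
apply: achieves_approx => n.
have n0 : 0 < n.+1%:R^-1 / 2 :> R by rewrite divr_gt0.
have [C [eps [eps0 inf]] CA] := sup_adherent n0 supA.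
have CleA : C <= sup A.
  by apply: ub_le_sup; [exact: (proj2 supA) | exists eps].
move/cvgrPdist_lt : eps0 => /(_ _ n0)[N _ NP].
have [k [P [Nk SP cP]]] := inf (maxn n N).
have := NP k (leq_trans (leq_maxr _ _) Nk); rewrite /= sub0r normrN => epsn.
exists k, P, (C - eps k); split=> //; first exact: leq_trans (leq_maxl _ _) Nk.
rewrite opprB addrCA addrC (le_lt_trans (ler_normD _ _))//.
rewrite [ltRHS]splitr ltrD//.
by rewrite ger0_norm ?subr_ge0// ltrBlDr -ltrBlDl.
Qed.

(* Main.v *)
(* Following Cohn, Kleinberg, Szegedy and Umans: for a SUSP P of size s and
   width k, write each permutation of P as the concatenation of its s values, a
   row of width s * k.  The SUSP property says exactly that any three of these
   s! rows, not all equal, violate the edge condition somewhere; hence the graph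
   of the resulting puzzle is already the trivial matching.  As
   (s / e)^s <= s! <= s^s, the new rate (s!)^(1/(sk)) differs from s^(1/k) by at
   most the factor e^(-1/k), which tends to 1. *)
Require Import Defs.
From mathcomp Require Import all_boot all_order all_algebra all_fingroup.
From mathcomp Require Import all_classical all_reals all_analysis.

Import Order.TTheory GRing.Theory Num.Theory.
Import numFieldNormedType.Exports.
Local Open Scope classical_set_scope.
Local Open Scope ring_scope.

(** The values of [p] are the lines of a matrix flattened by [mxvec], so that
    [mxvec_index (enum_rank r) i] addresses symbol [i] of [p r]. *)
Definition perm_row (k : nat) (P : puzzle k) (p : {perm prow P}) :
    {ffun 'I_(#|{: prow P}| * k) -> 'I_3} :=
  [ffun j => mxvec (\matrix_(a, i) val (p (enum_val a)) i) ord0 j].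

Definition perm_puzzle (k : nat) (P : puzzle k) :
    puzzle (#|{: prow P}| * k) :=
  [set perm_row k P p | p : {perm prow P}]%SET.

Lemma perm_rowE (k : nat) (P : puzzle k) (p : {perm prow P}) (r : prow P)
    (i : 'I_k) :
  perm_row k P p (mxvec_index (enum_rank r) i) = val (p r) i.
Proof. by rewrite ffunE mxvecE mxE enum_rankK. Qed.

Lemma perm_row_inj (k : nat) (P : puzzle k) : injective (perm_row k P).
Proof.
move=> p q pq; apply/permP => r; apply/val_inj/ffunP => i.
by rewrite -!perm_rowE pq.
Qed.

Lemma card_prow (k : nat) (P : puzzle k) : #|{: prow P}| = #|P|.
Proof. by rewrite card_sig. Qed.

Lemma card_perm_puzzle (k : nat) (P : puzzle k) : #|perm_puzzle k P| = (#|P|)`!.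
Proof.
rewrite card_imset; last exact: perm_row_inj.
rewrite -card_prow -[in RHS]cardsT -card_perm.
by apply: eq_card => p; rewrite !inE; apply/esym/fintype.subsetP => x _; rewrite inE.
Qed.

(** A symbol equals exactly one of 1, 2, 3, so at each coordinate exactly one of the three
    conditions holds, never two. *)
Lemma puzzle_graph_diag (k : nat) (P : puzzle k) (u : prow P) :
  (u, u, u) \in puzzle_graph P.
Proof.
rewrite inE; apply/existsP => -[i]; rewrite /exactly_two_at /exactly_two /=.
by case: (val u i) => [[|[|[|]]]].
Qed.

Lemma puzzle_graph_perm_puzzle (k : nat) (P : puzzle k) :
  SUSP P -> puzzle_graph (perm_puzzle k P) = trivial_matching _.
Proof.
move=> SP; apply/setP => -[[u v] w]; apply/idP/imsetP; last first.
  by move=> [x _ [-> -> ->]]; exact: puzzle_graph_diag.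
have [p1 _ e1] := imsetP (valP u); have [p2 _ e2] := imsetP (valP v).
have [p3 _ e3] := imsetP (valP w); rewrite inE => /existsP no2.
have [[p12 p23]|[r [i two]]] := SP p1 p2 p3.
  exists u => //; congr (_, _, _); apply: val_inj.
    by rewrite e1 e2 p12.
  by rewrite e1 e3 p12 p23.
case: no2; exists (mxvec_index (enum_rank r) i).
by rewrite /exactly_two_at /= e1 e2 e3 !perm_rowE.
Qed.

Lemma simplifiable_perm_puzzle (k : nat) (P : puzzle k) :
  SUSP P -> simplifiable_SUSP (perm_puzzle k P).
Proof.
move=> SP; rewrite /simplifiable_SUSP puzzle_graph_perm_puzzle //.
exact: simplifies_refl.
Qed.

(** One-row puzzles have a single permutation. By maximality of the capacity this yields
    [1 <= C]. *)
Lemma SUSP_achieves1 (R : realType) : achieves SUSP (1 : R).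
Proof.
apply: achieves_approx => n; exists n, [set [ffun=> sym1]]%SET, 1; split=> //.
- move=> p1 p2 p3; left.
  have all1 (x y : prow [set [ffun=> sym1] : {ffun 'I_n -> 'I_3}]%SET) : x = y.
    apply: val_inj; have := valP x; have := valP y.
    by rewrite !finset.inE => /eqP -> /eqP ->.
  by split; apply/permP => x; exact: all1.
- by rewrite subrr normr0 invr_gt0.
- by rewrite cards1 expr1n.
Qed.

Lemma fact_leq_expn (n : nat) : (n`! <= n ^ n)%N.
Proof.
elim: n => // n IHn; rewrite factS expnS leq_pmul2l//.
by case: n IHn => // n /leq_trans-> //; rewrite leq_exp2r.
Qed.

(** The quotient of [n ^ n] by the factorial of [n] is one term of the exponential series at [n]. *)
Lemma exprn_le_expR_fact (R : realType) (n : nat) :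
  n%:R ^+ n <= expR n%:R * n`!%:R :> R.
Proof.
case: n => [|n]; first by rewrite expr0 expR0 fact0 mulr1.
rewrite -ler_pdivrMr ?ltr0n ?fact_gt0//.
by apply: le_trans (expR_ge1Dxn n _) => //; rewrite ler_wpDl.
Qed.

(** Taking roots of order [s * k] in the factorial bounds gives [a * expR (- k%:R^-1) <= b <= a];
    then [1 + x <= expR x] at [x = - k%:R^-1] makes the lower bound linear in [k%:R^-1]. *)
Lemma fact_root_bounds (R : realType) (s k : nat) (a b : R) :
    (0 < s)%N -> (0 < k)%N -> 0 < a -> 0 < b ->
    s%:R = a ^+ k -> s`!%:R = b ^+ (s * k) ->
  a * (1 - k%:R^-1) <= b <= a.
Proof.
move=> s0 k0 a0 b0 sa sb; have sk0 : (0 < s * k)%N by rewrite muln_gt0 s0.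
have ss : s%:R ^+ s = a ^+ (s * k) by rewrite sa -exprM mulnC.
apply/andP; split; last first.
  rewrite -(ler_pXn2r sk0) ?nnegrE ?(ltW a0) ?(ltW b0)// -sb -ss -natrX ler_nat.
  exact: fact_leq_expn.
have ab : a <= expR k%:R^-1 * b.
  rewrite -(ler_pXn2r sk0) ?nnegrE ?mulr_ge0 ?expR_ge0 ?(ltW a0) ?(ltW b0)//.
  rewrite exprMn -sb -ss -expRM_natl natrM -mulrA divff ?pnatr_eq0 -?lt0n//.
  by rewrite mulr1; exact: exprn_le_expR_fact.
apply: (@le_trans _ _ (a * expR (- k%:R^-1))).
  by rewrite ler_pM2l// expR_ge1Dx.
by rewrite expRN ler_pdivrMr ?expR_gt0// mulrC.
Qed.

(** The error [C - b] splits into [eps k] and the loss [a - b <= a / k], each kept below [d], half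
    the tolerance. The strict [n < k] and [0 < r] allow [r] to be recovered later as a real [k]-th
    root. *)
Lemma simplifiable_approx (R : realType) (C : R) : 1 <= C -> achieves SUSP C ->
  forall n : nat, exists (k : nat) (P : puzzle k) (r : R),
    [/\ (n < k)%N, 0 < r, simplifiable_SUSP P,
        `|C - r| < n.+1%:R^-1 & #|P|%:R = r ^+ k].
Proof.
move=> C1 [eps [eps0 inf]] n.
pose d : R := n.+1%:R^-1 / 2.
have d0 : 0 < d by rewrite divr_gt0.
have d1 : d < 1.
  rewrite ltr_pdivrMr// mul1r (@le_lt_trans _ _ 1) ?ltr1n//.
  by rewrite invf_le1 ?ler1n.
move/cvgrPdist_lt : eps0 => /(_ _ d0)[N _ NP].
(* Beyond [N], [eps k] is below [d]; beyond the Archimedean bound, [(C + 1) / k < d], where [C + 1]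
   bounds [a]. *)
have [k [P [mk SP cP]]] :=
  inf (maxn n.+1 (maxn N (Num.bound ((C + 1) / d)))).
move: mk; rewrite !geq_max => /and3P[nk Nk Bk].
have k0 : (0 < k)%N by exact: leq_trans nk.
have := NP k Nk; rewrite /= sub0r normrN => epsd.
pose a := C - eps k.
(* Here [eps k < d < 1 <= C]. *)
have a0 : 0 < a.
  rewrite subr_gt0 (le_lt_trans (ler_norm _))// (lt_trans epsd)//.
  exact: lt_le_trans C1.
have aC : a <= C + 1.
  rewrite lerD2l (le_trans (ler_norm _))// normrN.
  exact/ltW/(lt_trans epsd).
pose s := #|P|.
have s0 : (0 < s)%N by rewrite -(ltr0n R) cP exprn_gt0.
pose b : R := s`!%:R `^ (s * k)%:R^-1.
have f0 : 0 < s`!%:R :> R by rewrite ltr0n fact_gt0.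
have b0 : 0 < b by rewrite powR_gt0.
have sk0 : (0 < s * k)%N by rewrite muln_gt0 s0.
have sb : s`!%:R = b ^+ (s * k).
  rewrite -powR_mulrn ?ltW// -powRrM mulVf ?powRr1 ?ltW//.
  by rewrite pnatr_eq0 -lt0n.
have /andP[ab ba] := fact_root_bounds _ s k a b s0 k0 a0 b0 cP sb.
exists (#|{: prow P}| * k)%N, (perm_puzzle k P), b; split=> //.
- by rewrite card_prow (leq_trans nk)// leq_pmull.
- exact: simplifiable_perm_puzzle.
- have akd : a / k%:R < d.
    rewrite ltr_pdivrMr ?ltr0n// mulrC -ltr_pdivrMr//.
    apply: (@le_lt_trans _ _ ((C + 1) / d)).
      by rewrite ler_pM2r ?invr_gt0.
    apply: (lt_le_trans (archi_boundP _)); last by rewrite ler_nat.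
    by rewrite divr_ge0 ?(ltW d0)// addr_ge0// (le_trans _ C1).
  have abd : `|a - b| < d.
    rewrite ger0_norm ?subr_ge0// (le_lt_trans _ akd)//.
    by rewrite lerBlDr -lerBlDl; move: ab; rewrite mulrBr mulr1.
  have -> : C - b = eps k + (a - b) by rewrite /a addrA addrCA subrr addr0.
  by rewrite (le_lt_trans (ler_normD _ _))// [ltRHS]splitr ltrD.
- by rewrite card_perm_puzzle card_prow.
Qed.

Theorem lemma9 (R : realType) (C : R) (hC : is_SUSP_capacity C) :
  achieves simplifiable_SUSP C /\
  exists (k_ : nat -> nat) (P_ : forall i : nat, puzzle (k_ i)),
    [/\ forall i : nat, simplifiable_SUSP (P_ i),
        k_ i @[i --> \oo] --> \oo &
        (#|P_ i|%:R : R) `^ (k_ i)%:R^-1 @[i --> \oo] --> C].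
Proof.
have [achC maxC] := hC.
have approx := simplifiable_approx R C (maxC 1 (SUSP_achieves1 R)) achC.
split.
  apply: achieves_approx => n; have [k [P [r [nk _ SP Cr cP]]]] := approx n.
  by exists k, P, r; split=> //; exact: ltnW.
(* The type of a puzzle depends on its width, so both are chosen together as a dependent pair. *)
have /choice[f fP] (n : nat) : exists x : {k : nat & puzzle k},
    [/\ (n <= projT1 x)%N, simplifiable_SUSP (projT2 x) &
      `|C - (#|projT2 x|%:R : R) `^ (projT1 x)%:R^-1| < n.+1%:R^-1].
  have [k [P [r [nk r0 SP Cr cP]]]] := approx n.
  exists (existT _ k P); split=> //=; first exact: ltnW.
  rewrite cP -powR_mulrn ?ltW// -powRrM mulfV ?powRr1 ?ltW//.
  by rewrite pnatr_eq0 -lt0n (leq_trans _ nk).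
exists (fun i => projT1 (f i)), (fun i => projT2 (f i)); split.
- by move=> i; have [] := fP i.
- apply/cvgnyPge => A; exists A => // i /= Ai.
  by have [fi _ _] := fP i; exact: leq_trans fi.
- apply/cvgrPdist_lt => e e0.
  have [M] := @ltr_add_invr R 0 e e0; rewrite add0r => Me.
  exists M => // i /= Mi; have [_ _ fi] := fP i.
  apply: (lt_trans fi); apply: le_lt_trans Me.
  by rewrite lef_pV2 ?posrE// ler_nat ltnS.
Qed.
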